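(* Let $m\ge1$ be an integer and $f(z)=\sum_{n\ge0}a_nz^{-n/m}$ a Gevrey-1 series whose Borel transform $\widetilde f(\zeta)=\sum_{n\ge1}\frac{a_n\zeta^{n/m-1}}{\Gamma(n/m)}$ extends analytically to $\Omega^\star$ with $|\widetilde f(\zeta)\zeta^{\frac{m-1}{m}}|\le Ae^{B|\zeta|}$ on $\Omega^\star$ for some $A,B>0$. Let $d_n$ ($n\ge1$) be defined by: for $l=1,\dots,m$, $\widetilde g_l(\xi)=\big(\frac{\xi}{1-e^{-\xi}}\big)^{\frac lm-1}\sum_{k\ge0}\frac{a_{l+mk}\xi^k}{\Gamma(\frac lm+k)}$ (principal branch, extended holomorphically to $\Delta$) and $\widetilde g_l(-\ln s)=\sum_{j\ge0}d_{l+mj}(1-s)^j$ for $s\in D(1,1)$. Then for every $n\ge1$, $$d_n=\frac{1}{\Gamma(\frac nm)}\Big(a_n+\sum_{\substack{j\ge1,\ l\ge1\\ l+jm=n}}d_{\frac lm,j}\,a_l\Big),$$ where for $r>0$ and $j\ge1$ $$d_{r,j}=\Big(\sum_{1\le p\le j}\frac{B_{j,p}\big(\frac{1!}{2},\frac{2!}{3},\dots,\frac{i!}{i+1},\dots\big)}{\Gamma(r-p)}\Big)\frac{\Gamma(r+j)}{j!}.$$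
   Context: $\Delta$ is the image of the open disc $D(1,1)=\{s:|s-1|<1\}$ under $s\mapsto-\ln s$ (principal logarithm); $\Delta^\star=\Delta\setminus\{0\}$; $\mathbb{C}_m^\star$ is the $m$-sheeted covering of $\mathbb{C}^\star$ (points $(|x|,\arg x)$, $\arg x\in\mathbb{R}/2\pi m\mathbb{Z}$, projection $\pi(x)=|x|e^{i\arg x}$, $x^{k/m}$ of modulus $|x|^{k/m}$ and argument $\frac km\arg x$); $\Omega^\star=\pi^{-1}(\Delta^\star)$. Gevrey-1 means $|a_n|\le CK^n\Gamma(1+n/m)$. $1/\Gamma(r-p)$ denotes the (entire) reciprocal Gamma function, equal to $0$ at non-positive integers. $B_{j,p}(x_1,x_2,\dots)$ are the partial exponential Bell polynomials: $B_{j,p}=\sum\frac{j!}{\prod_{i\ge1}k_i!\,(i!)^{k_i}}\prod_{i\ge1}x_i^{k_i}$, the sum over nonnegative integers $k_1,k_2,\dots$ with $\sum_i k_i=p$ and $\sum_i ik_i=j$. *)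

(* Defs.v *)
From Stdlib Require Import Reals List Arith Factorial.
From Coquelicot Require Import Coquelicot.
Open Scope R_scope.

Definition cexp (z : C) : C := (exp (Re z) * cos (Im z), exp (Re z) * sin (Im z)).

Definition carg (z : C) : R :=
  let x := Re z in let y := Im z in
  if Rlt_dec 0 x then atan (y / x)
  else if Rlt_dec x 0 then
    (if Rle_dec 0 y then atan (y / x) + PI else atan (y / x) - PI)
  else if Rlt_dec 0 y then PI / 2
  else if Rlt_dec y 0 then - (PI / 2) else 0.

Definition clog (z : C) : C := (ln (Cmod z), carg z).

Definition cpow (z : C) (alpha : R) : C := cexp (RtoC alpha * clog z).

Definition Gamma (x : R) : R :=
  RInt_gen (fun t => Rpower t (x - 1) * exp (- t)) (at_right 0) (Rbar_locally p_infty).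

(** Entire reciprocal Gamma function on the reals:
    1/Gamma(x) = x(x+1)...(x+N-1) / Gamma(x+N) for any N with x+N>0;
    it vanishes at the non-positive integers. *)
Definition rgamma (x : R) : R :=
  let N := Z.to_nat (up (Rabs x)) in
  (fold_right Rmult 1 (map (fun i => x + INR i) (seq 0 N))) / Gamma (x + INR N).

Definition D11 (s : C) : Prop := Cmod (s - 1)%C < 1.
Definition DeltaSet (xi : C) : Prop := exists s, D11 s /\ xi = (- clog s)%C.
Definition Delta_star (xi : C) : Prop := DeltaSet xi /\ xi <> RtoC 0.

(** Points of the m-sheeted covering C^star_m are represented by log-coordinates
    w = ln|x| + i arg x, taken modulo 2 pi m i; the projection is cexp.
    A function on C^star_m is a function of w that is 2 pi m i-periodic.
    Omega_star = preimage of Delta_star corresponds to { w | Delta_star (cexp w) }. *)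
Definition Omega_star (w : C) : Prop := Delta_star (cexp w).

(** Partial exponential Bell polynomials B_{j,p}(x_1, x_2, ...).
    The index vectors (k_1,...,k_j) (k_i = 0 for i > j is forced by
    sum i k_i = j, and then each k_i <= j). *)
Fixpoint kvecs (len bound : nat) : list (list nat) :=
  match len with
  | O => nil :: nil
  | S l => flat_map (fun k => map (cons k) (kvecs l bound)) (seq 0 (S bound))
  end.

Fixpoint ksum (k : list nat) : nat :=
  match k with nil => 0%nat | c :: r => (c + ksum r)%nat end.
Fixpoint kwsum (i0 : nat) (k : list nat) : nat :=
  match k with nil => 0%nat | c :: r => (i0 * c + kwsum (S i0) r)%nat end.

Fixpoint kden (i0 : nat) (k : list nat) : R :=
  match k with nil => 1 | c :: r => INR (fact c) * (INR (fact i0)) ^ c * kden (S i0) r end.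
Fixpoint kmon (x : nat -> R) (i0 : nat) (k : list nat) : R :=
  match k with nil => 1 | c :: r => (x i0) ^ c * kmon x (S i0) r end.

Definition bell (j p : nat) (x : nat -> R) : R :=
  fold_right Rplus 0
    (map (fun k => INR (fact j) / kden 1 k * kmon x 1 k)
       (filter (fun k => andb (Nat.eqb (ksum k) p) (Nat.eqb (kwsum 1 k) j)) (kvecs j j))).

Definition bell_arg (i : nat) : R := INR (fact i) / INR (S i).

Definition drj (r : R) (j : nat) : R :=
  sum_n_m (fun p => bell j p bell_arg * rgamma (r - INR p)) 1 j
  * Gamma (r + INR j) / INR (fact j).

(* Main.v *)
Require Import Defs.
From Stdlib Require Import Reals ZArith List Lra Lia.
From Coquelicot Require Import Coquelicot.
Open Scope R_scope.

(** On the real points [s = 1 - t] with [t -> 0+], put [xi = - ln (1 - t) = t (1 + u)] with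
    [u = sum_{i >= 1} t^i / (i + 1)].  Since [1 - e^{-xi} = t], the function [g_l (- ln s)] equals
    [sum_k a_{l+mk} / Gamma (r + k) * t^k (1 + u)^(r + k - 1)] with [r = l / m].  The binomial
    expansion of [(1 + u)^(r + k - 1)], the identity
    [(r + k - 1) ... (r + k - p) / Gamma (r + k) = 1 / Gamma (r + k - p)], and
    [u^p / p! = sum_j B_{j,p} (1!/2, 2!/3, ...) t^j / j!] give the coefficient of [t^j].
    Comparing asymptotic expansions of finite order at [0+], for real and imaginary parts
    separately, avoids any rearrangement of infinite series. *)

(** * Limits and integrals on the positive half-line *)

Lemma at_right_0_lt (e : R) : 0 < e -> at_right 0 (fun t => 0 < t < e).
Proof.
  intros He; exists (mkposreal e He); intros t Ht H0; split; trivial.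
  change (Rabs (t - 0) < e) in Ht; rewrite Rminus_0_r, Rabs_pos_eq in Ht; lra.
Qed.

Lemma at_right_0_intro (e : R) (P : R -> Prop) : 0 < e -> (forall t, 0 < t < e -> P t) ->
  at_right 0 P.
Proof.
  intros He HP; exact (filter_imp _ _ HP (at_right_0_lt e He)).
Qed.

Lemma filterlim_at_right_0 {T : Type} (F : (T -> Prop) -> Prop) {FF : Filter F} (f : T -> R) :
  filterlim f F (locally 0) -> F (fun t => 0 < f t) -> filterlim f F (at_right 0).
Proof.
  intros Hf Hpos P HP; generalize (filter_and _ _ (Hf _ HP) Hpos).
  apply filter_imp; intros t [H H0]; exact (H H0).
Qed.

Lemma filter_prod_at_right_0_p_infty (a b : R) : 0 < a ->
  filter_prod (at_right 0) (Rbar_locally p_infty) (fun ab => 0 < fst ab < a /\ b < snd ab).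
Proof.
  intros Ha; apply Filter_prod with (fun t => 0 < t < a) (fun t => b < t).
  - now apply at_right_0_lt.
  - now exists b.
  - now split.
Qed.

Lemma ex_RInt_continuous_pos (f : R -> R) (a b : R) : (forall t, 0 < t -> continuous f t) ->
  0 < a -> 0 < b -> ex_RInt f a b.
Proof.
  intros Hf Ha Hb; apply (ex_RInt_continuous (V := R_CompleteNormedModule)); intros t Ht.
  apply Hf, Rlt_le_trans with (2 := proj1 Ht); now apply Rmin_glb_lt.
Qed.

Lemma RInt_le_subinterval (f : R -> R) (a a' b' b : R) :
  (forall t, 0 < t -> 0 <= f t) -> (forall t, 0 < t -> continuous f t) ->
  0 < a <= a' -> a' <= b' -> b' <= b -> RInt f a' b' <= RInt f a b.
Proof.
  intros Hpos Hf Ha Hab Hb.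
  assert (Hex : forall s t, 0 < s -> 0 < t -> ex_RInt f s t)
    by now intros; apply ex_RInt_continuous_pos.
  assert (Hge : forall s t, 0 < s <= t -> 0 <= RInt f s t).
  { intros s t Hst; apply RInt_ge_0; [lra|apply Hex; lra|intros; apply Hpos; lra]. }
  rewrite <- (RInt_Chasles f a a' b), <- (RInt_Chasles f a' b' b) by (apply Hex; lra).
  assert (H1 := Hge a a' ltac:(lra)); assert (H2 := Hge b' b ltac:(lra)).
  unfold plus; simpl; lra.
Qed.

Lemma is_RInt_gen_of_bounded (f : R -> R) (M : R) :
  (forall t, 0 < t -> 0 <= f t) -> (forall t, 0 < t -> continuous f t) ->
  (forall a b, 0 < a <= b -> RInt f a b <= M) ->
  exists L, is_RInt_gen f (at_right 0) (Rbar_locally p_infty) L /\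
    forall a b, 0 < a <= b -> RInt f a b <= L.
Proof.
  intros Hpos Hf HM.
  destruct (completeness (fun v => exists a b, 0 < a <= b /\ v = RInt f a b)) as [L [Hub Hlub]].
  - exists M; intros v (a & b & Hab & ->); now apply HM.
  - exists (RInt f 1 1), 1, 1; split; [lra|reflexivity].
  - assert (HL : forall a b, 0 < a <= b -> RInt f a b <= L)
      by (intros a b Hab; apply Hub; now exists a, b).
    exists L; split; [|exact HL]; intros P [eps HP].
    assert (Hnear : exists a b, 0 < a <= b /\ L - eps < RInt f a b).
    { apply Classical_Prop.NNPP; intros Hno.
      enough (L <= L - eps) by (generalize (cond_pos eps); lra).
      apply Hlub; intros v (a & b & Hab & ->); apply Rnot_lt_le; intros Hlt; apply Hno.
      now exists a, b. }
    destruct Hnear as (a0 & b0 & Hab0 & Hlt).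
    unfold filtermapi; generalize (filter_prod_at_right_0_p_infty a0 b0 (proj1 Hab0)).
    apply filter_imp; intros [a b] [Ha Hb]; simpl in Ha, Hb; exists (RInt f a b); split.
    + apply (RInt_correct (V := R_CompleteNormedModule)).
      apply ex_RInt_continuous_pos; [trivial|simpl; lra..].
    + apply HP; change (Rabs (RInt f a b - L) < eps).
      assert (H1 := HL a b ltac:(lra)).
      assert (H2 := RInt_le_subinterval f a a0 b0 b Hpos Hf ltac:(lra) (proj2 Hab0) ltac:(lra)).
      apply Rabs_def1; generalize (cond_pos eps); lra.
Qed.

Lemma is_RInt_gen_derive_0_p_infty (F f : R -> R) (la lb : R) :
  (forall t, 0 < t -> is_derive F t (f t)) -> (forall t, 0 < t -> continuous f t) ->
  filterlim F (at_right 0) (locally la) -> filterlim F (Rbar_locally p_infty) (locally lb) ->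
  is_RInt_gen f (at_right 0) (Rbar_locally p_infty) (lb - la).
Proof.
  intros HF Hf Hla Hlb P HP.
  assert (Hlim : filterlim (fun ab => minus (F (snd ab)) (F (fst ab)))
    (filter_prod (at_right 0) (Rbar_locally p_infty)) (locally (lb - la))).
  { apply (filterlim_comp_2 (G := locally lb) (H := locally (opp la))
      (fun ab => F (snd ab)) (fun ab => opp (F (fst ab))) plus).
    - exact (filterlim_comp _ _ _ snd F _ _ _ filterlim_snd Hlb).
    - apply (filterlim_comp _ _ _ (fun ab => F (fst ab)) opp _ (locally la)).
      + exact (filterlim_comp _ _ _ fst F _ _ _ filterlim_fst Hla).
      + exact (filterlim_opp (V := R_NormedModule) la).
    - apply (filterlim_plus (V := R_NormedModule)). }
  specialize (Hlim P HP); unfold filtermap in Hlim; unfold filtermapi.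
  generalize (filter_and _ _ Hlim (filter_prod_at_right_0_p_infty 1 1 Rlt_0_1)).
  apply filter_imp; intros [a b] [HPab [Ha Hb]]; simpl in *.
  exists (minus (F b) (F a)); split; [|exact HPab].
  apply (is_RInt_derive (V := R_CompleteNormedModule));
    rewrite Rmin_left, Rmax_right by lra; intros t Ht; [apply HF|apply Hf]; lra.
Qed.

(** * The Gamma function *)

Definition gamma_integrand (x t : R) : R := Rpower t (x - 1) * exp (- t).

Lemma is_derive_Rpower (y t : R) : 0 < t ->
  is_derive (fun s => Rpower s y) t (y * Rpower t (y - 1)).
Proof.
  intros Ht; apply is_derive_Reals, derivable_pt_lim_power, Ht.
Qed.

Lemma continuous_Rpower (y t : R) : 0 < t -> continuous (fun s => Rpower s y) t.
Proof.
  intros Ht; apply (ex_derive_continuous (fun s => Rpower s y)).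
  eexists; apply is_derive_Rpower, Ht.
Qed.

Lemma exp_le (x y : R) : x <= y -> exp x <= exp y.
Proof.
  intros [H| ->]; [left; now apply exp_increasing|right; reflexivity].
Qed.

Lemma Rpower_le_exp (c y : R) : 0 < c -> 0 < y -> Rpower y c <= Rpower c c * exp y.
Proof.
  intros Hc Hy; unfold Rpower; rewrite <- exp_plus; apply exp_le.
  assert (Hyc : 0 < y / c) by now apply Rdiv_lt_0_compat.
  assert (Hln : ln (y / c) <= y / c).
  { rewrite <- (ln_exp (y / c)) at 2; apply ln_le; trivial.
    generalize (exp_ineq1_le (y / c)); lra. }
  replace (ln y) with (ln (y / c) + ln c)
    by (rewrite <- ln_mult by trivial; f_equal; field; lra).
  replace (c * ln c + y) with (c * (y / c + ln c)) by (field; lra).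
  apply Rmult_le_compat_l; lra.
Qed.

Lemma continuous_gamma_integrand (x t : R) : 0 < t -> continuous (gamma_integrand x) t.
Proof.
  intros Ht; apply (continuous_mult (K := R_AbsRing)).
  - now apply continuous_Rpower.
  - apply (ex_derive_continuous (fun s => exp (- s))); auto_derive; trivial.
Qed.

Lemma gamma_integrand_pos (x t : R) : 0 < gamma_integrand x t.
Proof.
  apply Rmult_lt_0_compat; apply exp_pos.
Qed.

Lemma is_derive_Rpower_div_1_plus (x t : R) : 0 < t ->
  is_derive (fun s => Rpower (s / (1 + s)) x) t (x * Rpower (t / (1 + t)) (x - 1) / (1 + t) ^ 2).
Proof.
  intros Ht.
  replace (x * _ / (1 + t) ^ 2) with (scal (/ (1 + t) ^ 2) (x * Rpower (t / (1 + t)) (x - 1)))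
    by (unfold scal; simpl; unfold mult; simpl; unfold Rdiv; ring).
  apply (is_derive_comp (fun y => Rpower y x) (fun s => s / (1 + s))).
  - apply is_derive_Rpower, Rdiv_lt_0_compat; lra.
  - auto_derive; [lra|field; lra].
Qed.

Lemma gamma_integrand_le (x t : R) : 0 < x -> 0 < t ->
  gamma_integrand x t
    <= Rpower (x + 1) (x + 1) * exp 1 * (Rpower (t / (1 + t)) (x - 1) / (1 + t) ^ 2).
Proof.
  intros Hx Ht; unfold gamma_integrand.
  assert (Hsplit : Rpower t (x - 1) = Rpower (t / (1 + t)) (x - 1) * Rpower (1 + t) (x - 1)).
  { rewrite Rpower_mult_distr by (try apply Rdiv_lt_0_compat; lra); f_equal; field; lra. }
  assert (Hexp : Rpower (1 + t) (x - 1) * (1 + t) ^ 2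
    <= Rpower (x + 1) (x + 1) * exp 1 * exp t).
  { rewrite <- Rpower_pow, <- Rpower_plus, Rmult_assoc, <- exp_plus by lra.
    replace (x - 1 + INR 2) with (x + 1) by (simpl; ring); apply Rpower_le_exp; lra. }
  rewrite Hsplit, exp_Ropp.
  assert (H2 : 0 < (1 + t) ^ 2) by (apply pow_lt; lra).
  assert (He := exp_pos t).
  apply Rmult_le_reg_r with ((1 + t) ^ 2 * exp t); [now apply Rmult_lt_0_compat|].
  replace (_ * ((1 + t) ^ 2 * exp t))
    with (Rpower (t / (1 + t)) (x - 1) * (Rpower (1 + t) (x - 1) * (1 + t) ^ 2)) by (field; lra).
  replace (_ * ((1 + t) ^ 2 * exp t))
    with (Rpower (t / (1 + t)) (x - 1) * (Rpower (x + 1) (x + 1) * exp 1 * exp t)) by (field; lra).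
  apply Rmult_le_compat_l; [left; apply exp_pos|exact Hexp].
Qed.

(* The bound of [gamma_integrand_le] is a multiple of the derivative of [(t / (1 + t)) ^ x], and
   that power lies in [0, 1]. *)
Lemma RInt_gamma_integrand_le (x a b : R) : 0 < x -> 0 < a <= b ->
  RInt (gamma_integrand x) a b <= Rpower (x + 1) (x + 1) * exp 1 / x.
Proof.
  intros Hx Hab.
  set (K := Rpower (x + 1) (x + 1) * exp 1 / x).
  set (G := fun t => Rpower (t / (1 + t)) x).
  set (G' := fun t => x * Rpower (t / (1 + t)) (x - 1) / (1 + t) ^ 2).
  assert (HK : 0 < K).
  { apply Rdiv_lt_0_compat; [apply Rmult_lt_0_compat; apply exp_pos|trivial]. }
  assert (HI : is_RInt (fun t => K * G' t) a b (K * (G b - G a))).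
  { apply (is_RInt_scal (V := R_NormedModule)), (is_RInt_derive (V := R_CompleteNormedModule));
      rewrite Rmin_left, Rmax_right by lra; intros t Ht.
    - apply is_derive_Rpower_div_1_plus; lra.
    - apply (continuous_mult (K := R_AbsRing)).
      + apply (continuous_scal_r (V := R_NormedModule)).
        apply (continuous_comp (fun s => s / (1 + s)) (fun y => Rpower y (x - 1))).
        * apply (ex_derive_continuous (fun s => s / (1 + s))); auto_derive; lra.
        * apply continuous_Rpower, Rdiv_lt_0_compat; lra.
      + apply (ex_derive_continuous (fun s => / (1 + s) ^ 2)); auto_derive; nra. }
  apply Rle_trans with (K * (G b - G a)).
  - rewrite <- (is_RInt_unique _ _ _ _ HI); apply RInt_le.
    + lra.
    + apply ex_RInt_continuous_pos; [apply continuous_gamma_integrand|lra..].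
    + eexists; exact HI.
    + intros t Ht; apply Rle_trans with (1 := gamma_integrand_le x t Hx ltac:(lra)).
      right; unfold K, G'; field; lra.
  - rewrite <- (Rmult_1_r K) at 2; apply Rmult_le_compat_l; [lra|].
    assert (HGa : 0 < G a) by apply exp_pos.
    enough (G b <= 1) by lra.
    rewrite <- exp_0; apply exp_le.
    assert (ln (b / (1 + b)) <= 0).
    { rewrite <- ln_1; apply ln_le; [apply Rdiv_lt_0_compat; lra|].
      apply Rmult_le_reg_r with (1 + b); [lra|].
      unfold Rdiv; rewrite Rmult_assoc, Rinv_l; lra. }
    nra.
Qed.

Lemma is_RInt_gen_gamma (x : R) : 0 < x ->
  exists L, 0 < L /\ is_RInt_gen (gamma_integrand x) (at_right 0) (Rbar_locally p_infty) L.
Proof.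
  intros Hx.
  destruct (is_RInt_gen_of_bounded (gamma_integrand x) (Rpower (x + 1) (x + 1) * exp 1 / x))
    as (L & HI & HL).
  - intros t _; left; apply gamma_integrand_pos.
  - apply continuous_gamma_integrand.
  - now intros a b; apply RInt_gamma_integrand_le.
  - exists L; split; [|exact HI].
    apply Rlt_le_trans with (RInt (gamma_integrand x) 1 2); [|apply HL; lra].
    apply RInt_gt_0; [lra| |].
    + intros; apply gamma_integrand_pos.
    + intros; apply continuous_gamma_integrand; lra.
Qed.

Lemma filterlim_Rpower_exp_at_right_0 (x : R) : 0 < x ->
  filterlim (fun t => Rpower t x * exp (- t)) (at_right 0) (locally 0).
Proof.
  intros Hx.
  assert (Hpow : filterlim (fun t => Rpower t x) (at_right 0) (locally 0)).
  { apply (filterlim_comp _ _ _ (fun t => x * ln t) exp _ (Rbar_locally m_infty));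
      [|exact is_lim_exp_m].
    apply filterlim_comp with (1 := is_lim_ln_0).
    assert (Hinf : Rbar_mult x m_infty = m_infty)
      by (apply is_Rbar_mult_unique, is_Rbar_mult_sym, is_Rbar_mult_m_infty_pos; exact Hx).
    rewrite <- Hinf at 2; apply filterlim_Rbar_mult_l. }
  refine (filterlim_le_le (fun _ => 0) _ _ 0 _ (filterlim_const 0) Hpow).
  apply (at_right_0_intro 1 _ Rlt_0_1); intros t Ht; split.
  - left; apply Rmult_lt_0_compat; apply exp_pos.
  - rewrite <- (Rmult_1_r (Rpower t x)) at 2; apply Rmult_le_compat_l; [left; apply exp_pos|].
    rewrite <- exp_0; apply exp_le; lra.
Qed.

Lemma filterlim_Rpower_exp_p_infty (x : R) : 0 < x ->
  filterlim (fun t => Rpower t x * exp (- t)) (Rbar_locally p_infty) (locally 0).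
Proof.
  intros Hx; set (K := Rpower (x + 1) (x + 1)).
  assert (HK : filterlim (fun t => K * / t) (Rbar_locally p_infty) (locally 0)).
  { rewrite <- (Rmult_0_r K).
    apply filterlim_comp with (G := locally 0).
    - now apply (filterlim_Rbar_inv p_infty).
    - apply (filterlim_scal_r (V := R_NormedModule)). }
  refine (filterlim_le_le (fun _ => 0) _ _ 0 _ (filterlim_const 0) HK).
  exists 0; intros t Ht; split.
  - left; apply Rmult_lt_0_compat; apply exp_pos.
  - assert (Hle := Rpower_le_exp (x + 1) t ltac:(lra) Ht); fold K in Hle.
    rewrite Rpower_plus, Rpower_1 in Hle by trivial.
    assert (He := exp_pos t).
    apply Rmult_le_reg_r with (t * exp t); [now apply Rmult_lt_0_compat|].
    rewrite exp_Ropp.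
    replace (Rpower t x * / exp t * (t * exp t)) with (Rpower t x * t) by (field; lra).
    now replace (K * / t * (t * exp t)) with (K * exp t) by (field; lra).
Qed.

Lemma is_derive_Rpower_exp (x t : R) : 0 < t ->
  is_derive (fun s => Rpower s x * exp (- s)) t
    (x * gamma_integrand x t - gamma_integrand (x + 1) t).
Proof.
  intros Ht; unfold gamma_integrand.
  replace (x + 1 - 1) with x by ring.
  replace (x * (Rpower t (x - 1) * exp (- t)) - Rpower t x * exp (- t))
    with (plus (mult (x * Rpower t (x - 1)) (exp (- t))) (mult (Rpower t x) (- exp (- t))))
    by (unfold plus, mult; simpl; ring).
  apply (is_derive_mult (fun s => Rpower s x) (fun s => exp (- s)) t
    (x * Rpower t (x - 1)) (- exp (- t))).
  - now apply is_derive_Rpower.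
  - auto_derive; trivial; ring.
  - intros; apply Rmult_comm.
Qed.

Lemma is_RInt_gen_gamma_plus_1 (x L : R) : 0 < x ->
  is_RInt_gen (gamma_integrand x) (at_right 0) (Rbar_locally p_infty) L ->
  is_RInt_gen (gamma_integrand (x + 1)) (at_right 0) (Rbar_locally p_infty) (x * L).
Proof.
  intros Hx HL.
  assert (HB : is_RInt_gen (fun t => x * gamma_integrand x t - gamma_integrand (x + 1) t)
    (at_right 0) (Rbar_locally p_infty) (0 - 0)).
  { apply is_RInt_gen_derive_0_p_infty with (fun t => Rpower t x * exp (- t)).
    - intros t Ht; now apply is_derive_Rpower_exp.
    - intros t Ht; apply (continuous_minus (V := R_NormedModule)).
      + now apply (continuous_scal_r (V := R_NormedModule)), continuous_gamma_integrand.
      + now apply continuous_gamma_integrand.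
    - now apply filterlim_Rpower_exp_at_right_0.
    - now apply filterlim_Rpower_exp_p_infty. }
  assert (H := is_RInt_gen_minus _ _ _ _ (is_RInt_gen_scal _ x _ HL) HB).
  replace (x * L) with (minus (scal x L) (0 - 0))
    by (unfold minus, plus, opp, scal; simpl; unfold mult; simpl; ring).
  revert H; apply is_RInt_gen_ext, filter_forall; intros ab t _.
  unfold minus, plus, opp, scal; simpl; unfold mult; simpl; ring.
Qed.

Lemma is_RInt_gen_Gamma (x L : R) :
  is_RInt_gen (gamma_integrand x) (at_right 0) (Rbar_locally p_infty) L -> Gamma x = L.
Proof.
  apply (is_RInt_gen_unique (V := R_CompleteNormedModule)).
Qed.

Lemma Gamma_pos (x : R) : 0 < x -> 0 < Gamma x.
Proof.
  intros Hx; destruct (is_RInt_gen_gamma x Hx) as (L & HL & HI).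
  now rewrite (is_RInt_gen_Gamma _ _ HI).
Qed.

Lemma Gamma_plus_1 (x : R) : 0 < x -> Gamma (x + 1) = x * Gamma x.
Proof.
  intros Hx; destruct (is_RInt_gen_gamma x Hx) as (L & _ & HI).
  rewrite (is_RInt_gen_Gamma _ _ HI).
  now apply is_RInt_gen_Gamma, is_RInt_gen_gamma_plus_1.
Qed.

Fixpoint falling (x : R) (p : nat) : R :=
  match p with O => 1 | S p' => x * falling (x - 1) p' end.

Definition rising (x : R) (N : nat) : R := fold_right Rmult 1 (map (fun i => x + INR i) (seq 0 N)).

Lemma rising_S (x : R) (N : nat) : rising x (S N) = rising x N * (x + INR N).
Proof.
  unfold rising; rewrite seq_S, map_app; simpl.
  induction (map (fun i => x + INR i) (seq 0 N)) as [|y l IH]; simpl; [ring|rewrite IH; ring].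
Qed.

Lemma rising_falling (p : nat) : forall x, rising (x - INR p) p = falling (x - 1) p.
Proof.
  induction p as [|p IH]; intros x; [reflexivity|].
  rewrite rising_S, S_INR; simpl falling; rewrite <- IH.
  replace (x - (INR p + 1)) with (x - 1 - INR p) by ring; ring.
Qed.

Lemma rising_div_Gamma (x : R) (N k : nat) : 0 < x + INR N ->
  rising x (N + k) / Gamma (x + INR (N + k)) = rising x N / Gamma (x + INR N).
Proof.
  intros HN; induction k as [|k IH]; [now rewrite Nat.add_0_r|].
  rewrite Nat.add_succ_r, rising_S, S_INR, <- IH.
  assert (0 < x + INR (N + k)) by (rewrite plus_INR; generalize (pos_INR k); lra).
  rewrite <- Rplus_assoc, Gamma_plus_1 by trivial.
  assert (0 < Gamma (x + INR (N + k))) by now apply Gamma_pos.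
  field; lra.
Qed.

Lemma rgamma_minus_INR (r : R) (p : nat) : 0 < r ->
  rgamma (r - INR p) = falling (r - 1) p / Gamma r.
Proof.
  intros Hr; unfold rgamma; fold (rising (r - INR p) (Z.to_nat (up (Rabs (r - INR p))))).
  set (x := r - INR p); set (N := Z.to_nat (up (Rabs x))).
  assert (HN : 0 < x + INR N).
  { destruct (archimed (Rabs x)) as [H _].
    assert (0 <= up (Rabs x))%Z by (apply le_IZR; generalize (Rabs_pos x); simpl; lra).
    unfold N; rewrite INR_IZR_INZ, Z2Nat.id by trivial.
    generalize (Rabs_maj2 x); lra. }
  assert (Hp : 0 < x + INR p) by (unfold x; lra).
  rewrite <- (rising_div_Gamma x N p HN), Nat.add_comm, (rising_div_Gamma x p N Hp).
  unfold x; rewrite rising_falling; f_equal; f_equal; ring.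
Qed.

(** * Asymptotic expansions at 0+ *)

(* [f t = sum_{n < N} c n * t ^ n + O(t ^ N)] as [t -> 0+], coefficient by coefficient. *)
Fixpoint is_expansion (N : nat) (f : R -> R) (c : nat -> R) : Prop :=
  match N with
  | O => exists M, at_right 0 (fun t => Rabs (f t) <= M)
  | S N' => exists g, at_right 0 (fun t => f t = c O + t * g t) /\ is_expansion N' g (PS_decr_1 c)
  end.

Lemma is_expansion_ext (N : nat) : forall f g c e, at_right 0 (fun t => f t = g t) ->
  (forall n, (n < N)%nat -> c n = e n) -> is_expansion N f c -> is_expansion N g e.
Proof.
  induction N as [|N IH]; simpl; intros f g c e Hfg Hce.
  - intros [M HM]; exists M; generalize (filter_and _ _ Hfg HM); apply filter_imp.
    intros t [<- H]; exact H.
  - intros (h & Hh & HN); exists h; split.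
    + generalize (filter_and _ _ Hfg Hh); apply filter_imp; intros t [<- ->].
      rewrite Hce by lia; reflexivity.
    + revert HN; apply IH; [now apply filter_forall|intros n Hn; apply Hce; lia].
Qed.

Lemma is_expansion_ext_coef (N : nat) (f : R -> R) (c e : nat -> R) :
  (forall n, c n = e n) -> is_expansion N f c -> is_expansion N f e.
Proof.
  intros Hce; apply is_expansion_ext; [now apply filter_forall|trivial].
Qed.

Lemma is_expansion_bounded (N : nat) : forall f c, is_expansion N f c ->
  exists M, at_right 0 (fun t => Rabs (f t) <= M).
Proof.
  induction N as [|N IH]; intros f c; [trivial|].
  intros (g & Hg & HN); destruct (IH _ _ HN) as [M HM].
  exists (Rabs (c O) + M).
  generalize (filter_and _ _ (at_right_0_lt 1 Rlt_0_1) (filter_and _ _ Hg HM)).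
  apply filter_imp; intros t (Ht & -> & H).
  eapply Rle_trans; [apply Rabs_triang|]; apply Rplus_le_compat_l.
  rewrite Rabs_mult, (Rabs_pos_eq t) by lra.
  generalize (Rabs_pos (g t)); nra.
Qed.

Lemma is_expansion_weaken (N : nat) : forall f c, is_expansion (S N) f c -> is_expansion N f c.
Proof.
  induction N as [|N IH]; intros f c.
  - apply is_expansion_bounded.
  - intros (g & Hg & HN); exists g; split; [trivial|]; now apply IH.
Qed.

Lemma is_expansion_0_continuous (f : R -> R) (c : nat -> R) : continuous f 0 -> is_expansion 0 f c.
Proof.
  intros Hf; exists (Rabs (f 0) + 1).
  apply (filter_le_within (F := locally 0)).
  assert (Hball : locally (f 0) (fun y => Rabs (y - f 0) < 1))
    by (exists (mkposreal 1 Rlt_0_1); intros y Hy; exact Hy).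
  assert (Hnear := Hf _ Hball); revert Hnear; unfold filtermap; apply filter_imp; intros t Ht.
  generalize (Rabs_triang_inv (f t) (f 0)); lra.
Qed.

Lemma is_expansion_monomial (N : nat) : forall (w : R) (e : nat),
  is_expansion N (fun t => w * t ^ e) (fun n => if Nat.eqb e n then w else 0).
Proof.
  induction N as [|N IH]; intros w e.
  - apply is_expansion_0_continuous, (ex_derive_continuous (fun t => w * t ^ e)).
    auto_derive; trivial.
  - destruct e as [|e].
    + exists (fun t => 0 * t ^ 0); split; [apply filter_forall; intros t; simpl; ring|].
      generalize (IH 0 O); apply is_expansion_ext_coef; intros [|n]; reflexivity.
    + exists (fun t => w * t ^ e); split; [apply filter_forall; intros t; simpl; ring|].
      apply IH.
Qed.

Lemma is_expansion_plus (N : nat) : forall f g c e, is_expansion N f c -> is_expansion N g e ->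
  is_expansion N (fun t => f t + g t) (PS_plus c e).
Proof.
  induction N as [|N IH]; intros f g c e.
  - intros [M HM] [M' HM']; exists (M + M').
    generalize (filter_and _ _ HM HM'); apply filter_imp; intros t [H H'].
    eapply Rle_trans; [apply Rabs_triang|]; lra.
  - intros (h & Hh & HN) (h' & Hh' & HN'); exists (fun t => h t + h' t); split.
    + generalize (filter_and _ _ Hh Hh'); apply filter_imp; intros t [-> ->].
      unfold PS_plus, plus; simpl; ring.
    + exact (IH _ _ _ _ HN HN').
Qed.

Lemma is_expansion_scal (N : nat) (k : R) : forall f c, is_expansion N f c ->
  is_expansion N (fun t => k * f t) (PS_scal k c).
Proof.
  induction N as [|N IH]; intros f c.
  - intros [M HM]; exists (Rabs k * M); revert HM; apply filter_imp; intros t H.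
    rewrite Rabs_mult; apply Rmult_le_compat_l; [apply Rabs_pos|trivial].
  - intros (h & Hh & HN); exists (fun t => k * h t); split.
    + revert Hh; apply filter_imp; intros t ->.
      unfold PS_scal, scal; simpl; unfold mult; simpl; ring.
    + exact (IH _ _ HN).
Qed.

Lemma is_expansion_filterlim (N : nat) (f : R -> R) (c : nat -> R) :
  is_expansion (S N) f c -> filterlim f (at_right 0) (locally (c O)).
Proof.
  intros (g & Hg & HN); destruct (is_expansion_bounded _ _ _ HN) as [M HM].
  intros P [eps HP]; unfold filtermap.
  assert (HM1 : 0 < Rabs M + 1) by (generalize (Rabs_pos M); lra).
  assert (He : 0 < eps / (Rabs M + 1)) by (apply Rdiv_lt_0_compat; [apply cond_pos|trivial]).
  generalize (filter_and _ _ Hg (filter_and _ _ HM (at_right_0_lt _ He))).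
  apply filter_imp; intros t (Hf & Hgt & Ht).
  apply HP; change (Rabs (f t - c O) < eps).
  rewrite Hf; replace (c O + t * g t - c O) with (t * g t) by ring.
  rewrite Rabs_mult, (Rabs_pos_eq t) by lra.
  apply Rle_lt_trans with (t * (Rabs M + 1)).
  - apply Rmult_le_compat_l; [lra|]; generalize (Rle_abs M); lra.
  - replace (pos eps) with (eps / (Rabs M + 1) * (Rabs M + 1)) by (field; lra).
    apply Rmult_lt_compat_r; lra.
Qed.

Lemma is_expansion_unique (N : nat) : forall f c e, is_expansion N f c -> is_expansion N f e ->
  forall n, (n < N)%nat -> c n = e n.
Proof.
  induction N as [|N IH]; intros f c e Hc He; [lia|].
  assert (H0 : c O = e O) by exact (filterlim_locally_unique (V := R_NormedModule) f _ _
    (is_expansion_filterlim _ _ _ Hc) (is_expansion_filterlim _ _ _ He)).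
  destruct Hc as (g & Hg & HN), He as (h & Hh & HN').
  intros [|n] Hn; [trivial|].
  apply (IH g (PS_decr_1 c) (PS_decr_1 e) HN); [|lia].
  revert HN'; apply is_expansion_ext; [|trivial].
  generalize (filter_and _ _ (filter_and _ _ Hg Hh) (at_right_0_lt 1 Rlt_0_1)).
  apply filter_imp; intros t [[H1 H2] Ht].
  apply Rmult_eq_reg_l with t; lra.
Qed.

Lemma PS_mult_S (c e : nat -> R) (n : nat) :
  PS_mult c e (S n) = c O * e (S n) + PS_mult (PS_decr_1 c) e n.
Proof.
  unfold PS_mult; rewrite decomp_sum by lia; now rewrite Nat.sub_0_r.
Qed.

Lemma is_expansion_mult (N : nat) : forall f g c e, is_expansion N f c -> is_expansion N g e ->
  is_expansion N (fun t => f t * g t) (PS_mult c e).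
Proof.
  induction N as [|N IH]; intros f g c e Hf Hg.
  - destruct Hf as [M HM], Hg as [M' HM']; exists (M * M').
    generalize (filter_and _ _ HM HM'); apply filter_imp; intros t [H H'].
    rewrite Rabs_mult; apply Rmult_le_compat; trivial; apply Rabs_pos.
  - assert (Hg' := is_expansion_weaken _ _ _ Hg).
    destruct Hf as (h & Hh & HN), Hg as (k & Hk & HN').
    exists (fun t => c O * k t + h t * g t); split.
    + generalize (filter_and _ _ Hh Hk); apply filter_imp; unfold PS_mult; simpl; intros t [-> H].
      rewrite Rmult_plus_distr_r; rewrite H at 1; ring.
    + generalize (is_expansion_plus _ _ _ _ _
        (is_expansion_scal _ (c O) _ _ HN') (IH _ _ _ _ HN Hg')).
      apply is_expansion_ext_coef; intros n; symmetry; apply PS_mult_S.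
Qed.

Fixpoint PS_pow (c : nat -> R) (p : nat) : nat -> R :=
  match p with
  | O => fun n => if Nat.eqb 0 n then 1 else 0
  | S p' => PS_mult c (PS_pow c p')
  end.

Lemma is_expansion_pow (N p : nat) (f : R -> R) (c : nat -> R) :
  is_expansion N f c -> is_expansion N (fun t => f t ^ p) (PS_pow c p).
Proof.
  intros H; induction p as [|p IH]; simpl.
  - generalize (is_expansion_monomial N 1 0); apply is_expansion_ext; [|trivial].
    apply filter_forall; intros t; simpl; ring.
  - now apply is_expansion_mult.
Qed.

Lemma PS_pow_eq_0 (c : nat -> R) (p : nat) : c O = 0 ->
  forall n, (n < p)%nat -> PS_pow c p n = 0.
Proof.
  intros Hc; induction p as [|p IH]; intros n Hn; [lia|].
  apply sum_eq_R0; intros [|k] Hk; [rewrite Hc; ring|].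
  rewrite IH by lia; ring.
Qed.

Definition PS_comp (a c : nat -> R) (n : nat) : R :=
  sum_f_R0 (fun p => a p * PS_pow c p n) n.

Lemma sum_f_R0_extend_0 (F : nat -> R) (j n : nat) : (j <= n)%nat ->
  (forall i, (j < i)%nat -> F i = 0) -> sum_f_R0 F n = sum_f_R0 F j.
Proof.
  intros Hj HF; induction Hj as [|n Hj IH]; [trivial|]; simpl.
  rewrite IH, HF by lia; ring.
Qed.

Lemma PS_comp_S (a c : nat -> R) (n : nat) : c O = 0 ->
  PS_comp a c (S n) = PS_mult (PS_decr_1 c) (PS_comp (PS_decr_1 a) c) n.
Proof.
  intros Hc; unfold PS_comp at 1.
  rewrite decomp_sum by lia; simpl PS_pow at 1; rewrite Rmult_0_r, Rplus_0_l.
  transitivity (sum_n (fun p => sum_n (fun i =>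
    PS_decr_1 c i * (PS_decr_1 a p * PS_pow c p (n - i))) n) n).
  - rewrite sum_n_Reals; apply sum_eq; intros p Hp; rewrite sum_n_Reals; simpl PS_pow.
    rewrite PS_mult_S, Hc, Rmult_0_l, Rplus_0_l; unfold PS_mult; rewrite scal_sum.
    apply sum_eq; intros i Hi; unfold PS_decr_1; ring.
  - rewrite sum_n_switch, sum_n_Reals; apply sum_eq; intros i Hi; unfold PS_comp.
    rewrite sum_n_Reals, scal_sum.
    rewrite (sum_f_R0_extend_0 _ (n - i) n); [|lia|].
    + apply sum_eq; intros p Hp; ring.
    + intros p Hp; rewrite PS_pow_eq_0 by trivial; ring.
Qed.

Lemma is_expansion_comp (v : R -> R) (c : nat -> R) (N : nat) :
  is_expansion N v c -> c O = 0 -> filterlim v (at_right 0) (at_right 0) ->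
  forall F a, is_expansion N F a -> is_expansion N (fun t => F (v t)) (PS_comp a c).
Proof.
  intros Hv Hc Hlim; induction N as [|N IH]; intros F a.
  - intros [M HM]; exists M; exact (Hlim _ HM).
  - specialize (IH (is_expansion_weaken _ _ _ Hv)).
    intros (G & HG & HN); destruct Hv as (w & Hw & HwN).
    exists (fun t => w t * G (v t)); split.
    + assert (HGv := Hlim _ HG); unfold filtermap in HGv.
      generalize (filter_and _ _ HGv Hw); apply filter_imp; intros t [-> Hvt].
      rewrite Hvt at 1; unfold PS_comp; simpl; rewrite Hc; ring.
    + generalize (is_expansion_mult _ _ _ _ _ HwN (IH _ _ HN)).
      apply is_expansion_ext_coef; intros n; symmetry; now apply PS_comp_S.
Qed.

Lemma Rabs_le_of_is_derive (f f' : R -> R) (t B : R) : 0 < t -> 0 <= B -> continuous f 0 ->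
  (forall s, 0 < s <= t -> is_derive f s (f' s) /\ Rabs (f' s) <= B) -> Rabs (f t - f 0) <= B * t.
Proof.
  intros Ht HB Hf Hder.
  (* [MVT_gen] only places the point in the closed interval, hence the value [0] at [0]. *)
  destruct (MVT_gen f 0 t (fun s => if Rlt_dec 0 s then f' s else 0)) as (s & Hs & ->).
  - rewrite Rmin_left, Rmax_right by lra; intros s Hs.
    destruct (Rlt_dec 0 s); [apply Hder; lra|lra].
  - rewrite Rmin_left, Rmax_right by lra; intros s Hs; apply continuity_pt_filterlim.
    destruct (Req_dec s 0) as [->|]; [exact Hf|].
    apply (ex_derive_continuous f); eexists; apply Hder; lra.
  - rewrite Rmin_left, Rmax_right in Hs by lra.
    rewrite Rminus_0_r, Rabs_mult, (Rabs_pos_eq t) by lra; apply Rmult_le_compat_r; [lra|].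
    destruct (Rlt_dec 0 s); [apply Hder; lra|now rewrite Rabs_R0].
Qed.

Lemma Rabs_le_pow_of_is_derive (f h : R -> R) (k : nat) (t M : R) : 0 < t ->
  continuous f 0 -> (forall s, 0 < s <= t -> is_derive f s (s ^ k * h s) /\ Rabs (h s) <= M) ->
  Rabs (f t - f 0) <= M * t ^ S k.
Proof.
  intros Ht Hf Hder.
  assert (HM : 0 <= M) by (generalize (proj2 (Hder t ltac:(lra))) (Rabs_pos (h t)); lra).
  replace (M * t ^ S k) with (M * t ^ k * t) by (simpl; ring).
  apply Rabs_le_of_is_derive with (fun s => s ^ k * h s); [trivial| |trivial|].
  - apply Rmult_le_pos; [trivial|apply pow_le; lra].
  - intros s Hs; split; [now apply Hder|].
    rewrite Rabs_mult, (Rabs_pos_eq (s ^ k)), (Rmult_comm M) by (apply pow_le; lra).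
    apply Rmult_le_compat; [apply pow_le; lra|apply Rabs_pos|apply pow_incr; lra|].
    now apply Hder.
Qed.

(* The factor [t ^ k] makes the induction on [N] go through: writing [h = c 0 + t h'] and
   subtracting [c 0 t ^ (k + 1) / (k + 1)] from [f] leaves a function with derivative
   [t ^ (k + 1) h']. *)
Lemma is_expansion_primitive_pow (N : nat) : forall k f h c, f 0 = 0 -> continuous f 0 ->
  at_right 0 (fun t => is_derive f t (t ^ k * h t)) -> is_expansion N h c ->
  is_expansion N (fun t => f t / t ^ S k) (fun n => c n / INR (S (n + k))).
Proof.
  induction N as [|N IH]; intros k f h c Hf0 Hf Hder.
  - intros [M HM]; exists M.
    destruct (filter_and _ _ Hder HM) as [e He].
    apply (at_right_0_intro e _ (cond_pos e)); intros t Ht.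
    assert (Hle : Rabs (f t - f 0) <= M * t ^ S k).
    { apply Rabs_le_pow_of_is_derive with h; [lra|trivial|intros s Hs; apply He; [|lra]].
      change (Rabs (s - 0) < e); rewrite Rminus_0_r, Rabs_pos_eq; lra. }
    assert (Htk : 0 < t ^ S k) by (apply pow_lt; lra).
    unfold Rdiv; rewrite Rabs_mult, Rabs_inv, (Rabs_pos_eq (t ^ S k)) by lra.
    apply Rmult_le_reg_r with (t ^ S k); [trivial|].
    rewrite Rmult_assoc, Rinv_l, Rmult_1_r by lra.
    now rewrite Hf0, Rminus_0_r in Hle.
  - intros (h' & Hh & HN).
    set (F := fun t => f t - c O / INR (S k) * t ^ S k).
    assert (HF : is_expansion N (fun t => F t / t ^ S (S k))
      (fun n => PS_decr_1 c n / INR (S (n + S k)))).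
    { apply IH with h'; trivial.
      - unfold F; simpl; rewrite Hf0; ring.
      - apply (continuous_minus (V := R_NormedModule)); [exact Hf|].
        apply (ex_derive_continuous (fun t => c O / INR (S k) * t ^ S k)); auto_derive; trivial.
      - generalize (filter_and _ _ Hder Hh); apply filter_imp; intros t [Hd Heq].
        replace (t ^ S k * h' t) with (minus (t ^ k * h t) (c O * t ^ k))
          by (rewrite Heq; unfold minus, plus, opp; simpl; ring).
        apply (is_derive_minus (V := R_NormedModule)); [exact Hd|].
        auto_derive; trivial.
        change (c O / INR (S k) * (1 * (INR (S k) * t ^ k)) = c O * t ^ k).
        field; apply not_0_INR; lia. }
    exists (fun t => F t / t ^ S (S k)); split.
    + apply (at_right_0_intro 1 _ Rlt_0_1); intros t Ht; unfold F.
      assert (Htk : t ^ S k <> 0) by (apply pow_nonzero; lra).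
      rewrite Nat.add_0_l; change (t ^ S (S k)) with (t * t ^ S k); field.
      repeat split; [apply not_0_INR; lia|trivial|lra].
    + revert HF; apply is_expansion_ext_coef; intros n; unfold PS_decr_1; do 3 f_equal; lia.
Qed.

Lemma is_expansion_primitive (N : nat) (f f' : R -> R) (c : nat -> R) : continuous f 0 ->
  at_right 0 (fun t => is_derive f t (f' t)) -> is_expansion N f' c ->
  is_expansion (S N) (fun t => f t - f 0) (PS_Int c).
Proof.
  intros Hf Hder HN; exists (fun t => (f t - f 0) / t ^ 1); split.
  - apply (at_right_0_intro 1 _ Rlt_0_1); intros t Ht; simpl; field; lra.
  - generalize (is_expansion_primitive_pow N 0 (fun t => f t - f 0) f' c).
    intros H; apply is_expansion_ext_coef with (fun n => c n / INR (S (n + 0))).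
    + intros n; now rewrite Nat.add_0_r.
    + apply H; trivial; [ring| |].
      * apply (continuous_minus (V := R_NormedModule)); [exact Hf|apply continuous_const].
      * revert Hder; apply filter_imp; intros t Hd.
        replace (t ^ 0 * f' t) with (minus (f' t) 0) by (unfold minus, plus, opp; simpl; ring).
        apply (is_derive_minus (V := R_NormedModule)); [exact Hd|auto_derive; trivial].
Qed.

Lemma is_expansion_PSeries (N : nat) : forall b, Rbar_lt 0 (CV_radius b) ->
  is_expansion N (PSeries b) b.
Proof.
  induction N as [|N IH]; intros b Hb.
  - apply is_expansion_0_continuous, continuity_pt_filterlim, PSeries_continuity.
    now rewrite Rabs_R0.
  - exists (PSeries (PS_decr_1 b)); split.
    + assert (He : exists e : R, 0 < e /\ Rbar_le e (CV_radius b)).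
      { destruct (CV_radius b) as [r| |]; simpl in Hb; [|exists 1; now split; [lra|]|contradiction].
        exists r; split; [trivial|apply Rbar_le_refl]. }
      destruct He as (e & He & Hle).
      apply (at_right_0_intro e _ He); intros t Ht.
      apply PSeries_decr_1, CV_radius_inside, Rbar_lt_le_trans with (2 := Hle).
      rewrite Rabs_pos_eq; simpl; lra.
    + apply IH; now rewrite CV_radius_decr_1.
Qed.

Lemma CV_radius_pos_of_is_pseries (b : nat -> R) (x l : R) : 0 < x -> is_pseries b x l ->
  Rbar_lt 0 (CV_radius b).
Proof.
  intros Hx Hs; apply is_pseries_R in Hs.
  apply Rbar_lt_le_trans with (Finite x); [exact Hx|].
  apply Rbar_not_lt_le; intros Hlt.
  apply (CV_disk_outside b x); [rewrite Rabs_pos_eq; trivial; lra|].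
  apply ex_series_lim_0; now exists l.
Qed.

Definition gbinom (alpha : R) (p : nat) : R := falling alpha p / INR (fact p).

Lemma gbinom_S (alpha : R) (p : nat) :
  gbinom alpha (S p) = alpha * gbinom (alpha - 1) p / INR (S p).
Proof.
  unfold gbinom; rewrite fact_simpl, mult_INR; simpl falling; field.
  split; [apply INR_fact_neq_0|apply not_0_INR; lia].
Qed.

Lemma is_derive_Rpower_1_plus (alpha x : R) : -1 < x ->
  is_derive (fun y => Rpower (1 + y) alpha) x (alpha * Rpower (1 + x) (alpha - 1)).
Proof.
  intros Hx; rewrite <- (Rmult_1_l (alpha * _)).
  apply (is_derive_comp (fun y => Rpower y alpha) (fun y => 1 + y)).
  - apply is_derive_Rpower; lra.
  - auto_derive; trivial; ring.
Qed.

Lemma is_expansion_Rpower_1_plus (N : nat) : forall alpha,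
  is_expansion N (fun x => Rpower (1 + x) alpha) (gbinom alpha).
Proof.
  assert (Hcont : forall alpha, continuous (fun x => Rpower (1 + x) alpha) 0).
  { intros alpha; apply (ex_derive_continuous (fun x => Rpower (1 + x) alpha)).
    eexists; apply is_derive_Rpower_1_plus; lra. }
  induction N as [|N IH]; intros alpha; [now apply is_expansion_0_continuous|].
  assert (Hder : at_right 0 (fun x =>
    is_derive (fun y => Rpower (1 + y) alpha) x (alpha * Rpower (1 + x) (alpha - 1)))).
  { apply (at_right_0_intro 1 _ Rlt_0_1); intros x Hx.
    apply is_derive_Rpower_1_plus; lra. }
  assert (Hprim := is_expansion_primitive N _ _ _ (Hcont alpha) Hder
    (is_expansion_scal _ alpha _ _ (IH (alpha - 1)))).
  generalize (is_expansion_plus _ _ _ _ _ Hprim (is_expansion_monomial (S N) 1 0)).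
  apply is_expansion_ext.
  - apply filter_forall; intros t; rewrite Rplus_0_r; unfold Rpower at 2.
    rewrite ln_1, Rmult_0_r, exp_0; simpl; ring.
  - intros [|n] _; unfold PS_plus, plus; simpl PS_Int; simpl.
    + unfold gbinom; simpl; field.
    + rewrite gbinom_S; apply Rplus_0_r.
Qed.

Lemma is_expansion_geom (N : nat) : is_expansion N (fun t => / (1 - t)) (fun _ => 1).
Proof.
  induction N as [|N IH].
  - apply is_expansion_0_continuous, (ex_derive_continuous (fun t => / (1 - t))).
    auto_derive; lra.
  - exists (fun t => / (1 - t)); split; [|exact IH].
    apply (at_right_0_intro 1 _ Rlt_0_1); intros t Ht; field; lra.
Qed.

Lemma is_expansion_neg_ln_1_minus (N : nat) :
  is_expansion N (fun t => - ln (1 - t)) (PS_Int (fun _ => 1)).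
Proof.
  apply is_expansion_weaken.
  assert (Hprim : is_expansion (S N) (fun t => - ln (1 - t) - - ln (1 - 0)) (PS_Int (fun _ => 1))).
  { apply (is_expansion_primitive N (fun t => - ln (1 - t)) (fun t => / (1 - t))).
    - apply (ex_derive_continuous (fun t => - ln (1 - t))); auto_derive; lra.
    - apply (at_right_0_intro 1 _ Rlt_0_1); intros t Ht.
      auto_derive; [lra|field; lra].
    - apply is_expansion_geom. }
  revert Hprim; apply is_expansion_ext; [|trivial].
  apply filter_forall; intros t; rewrite Rminus_0_r, ln_1; ring.
Qed.

Lemma is_expansion_div_id (N : nat) (f : R -> R) (c : nat -> R) : c O = 0 ->
  is_expansion (S N) f c -> is_expansion N (fun t => f t / t) (PS_decr_1 c).
Proof.
  intros Hc (g & Hg & HN); revert HN; apply is_expansion_ext; [|trivial].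
  generalize (filter_and _ _ Hg (at_right_0_lt 1 Rlt_0_1)).
  apply filter_imp; intros t [-> Ht]; rewrite Hc; field; lra.
Qed.

Section RpowerMultComp.

Variables (u : R -> R) (c : nat -> R).
Hypothesis Hu : forall N, is_expansion N u c.
Hypothesis Hc : c O = 0.
Hypothesis Hpos : at_right 0 (fun t => 0 < u t).

Lemma is_expansion_Rpower_1_plus_comp (N : nat) (alpha : R) :
  is_expansion N (fun t => Rpower (1 + u t) alpha) (PS_comp (gbinom alpha) c).
Proof.
  apply (is_expansion_comp u c N (Hu N) Hc) with (F := fun x => Rpower (1 + x) alpha).
  - apply filterlim_at_right_0; [apply at_right_proper_filter| |exact Hpos].
    assert (Hlim := is_expansion_filterlim 0 _ _ (Hu 1%nat)); now rewrite Hc in Hlim.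
  - apply is_expansion_Rpower_1_plus.
Qed.

Lemma filterlim_mult_1_plus_at_right_0 :
  filterlim (fun t => t * (1 + u t)) (at_right 0) (at_right 0).
Proof.
  apply filterlim_at_right_0; [apply at_right_proper_filter| |].
  - apply (is_expansion_filterlim 0 _ (fun _ => 0)).
    exists (fun t => 1 + u t); split; [apply filter_forall; intros t; ring|].
    generalize (is_expansion_plus 0 _ _ _ _ (is_expansion_monomial 0 1 0) (Hu O)).
    apply is_expansion_ext; [apply filter_forall; intros t; simpl; ring|lia].
  - generalize (filter_and _ _ Hpos (at_right_0_lt 1 Rlt_0_1)).
    apply filter_imp; intros t [Ht0 Ht]; apply Rmult_lt_0_compat; lra.
Qed.

(* Writing [F x = b 0 + x G x] and pulling out [t (1 + u)] shifts [b] and raises the exponent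
   by one. *)
Lemma is_expansion_Rpower_mult_comp (N : nat) : forall beta F b, is_expansion N F b ->
  is_expansion N (fun t => Rpower (1 + u t) beta * F (t * (1 + u t)))
    (fun n => sum_f_R0
       (fun j => b (n - j)%nat * PS_comp (gbinom (beta + INR (n - j))) c j) n).
Proof.
  induction N as [|N IH]; intros beta F b HF.
  - destruct HF as [M HM].
    apply (is_expansion_mult 0 _ _ (PS_comp (gbinom beta) c) b).
    + apply is_expansion_Rpower_1_plus_comp.
    + exists M; exact (filterlim_mult_1_plus_at_right_0 _ HM).
  - destruct HF as (G & HG & HN).
    apply is_expansion_ext with
      (fun t => b O * Rpower (1 + u t) beta
        + t * (Rpower (1 + u t) (beta + 1) * G (t * (1 + u t))))
      (PS_plus (PS_scal (b O) (PS_comp (gbinom beta) c))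
        (PS_incr_1 (fun n => sum_f_R0
          (fun j => b (S (n - j)) * PS_comp (gbinom (beta + 1 + INR (n - j))) c j) n))).
    + assert (HGv := filterlim_mult_1_plus_at_right_0 _ HG); unfold filtermap in HGv.
      generalize (filter_and _ _ Hpos HGv).
      apply filter_imp; intros t [Hp ->].
      rewrite Rpower_plus, Rpower_1 by lra; ring.
    + intros [|n] _; unfold PS_plus, PS_scal, PS_incr_1, plus, scal; simpl plus; simpl scal;
        unfold mult; simpl mult.
      * simpl; rewrite !Rplus_0_r; reflexivity.
      * rewrite tech5, Nat.sub_diag, Rplus_0_r, Rplus_comm; f_equal.
        apply sum_eq; intros j Hj.
        replace (S n - j)%nat with (S (n - j)) by lia.
        rewrite S_INR; do 3 f_equal; ring.
    + apply is_expansion_plus.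
      * apply is_expansion_scal, is_expansion_Rpower_1_plus_comp.
      * exists (fun t => Rpower (1 + u t) (beta + 1) * G (t * (1 + u t))).
        split; [apply filter_forall; intros t; unfold PS_incr_1, zero; simpl; ring|].
        exact (IH (beta + 1) G (PS_decr_1 b) HN).
Qed.

End RpowerMultComp.

(** * Bell polynomials *)

Definition sum_list {A : Type} (F : A -> R) (L : list A) : R := fold_right Rplus 0 (map F L).

Lemma sum_list_ext {A : Type} (F G : A -> R) (L : list A) :
  (forall k, F k = G k) -> sum_list F L = sum_list G L.
Proof.
  intros H; unfold sum_list; now rewrite (map_ext F G H).
Qed.

Lemma sum_list_app {A : Type} (F : A -> R) (L L' : list A) :
  sum_list F (L ++ L') = sum_list F L + sum_list F L'.
Proof.
  unfold sum_list; induction L as [|k L IH]; simpl; [ring|rewrite IH; ring].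
Qed.

Lemma sum_list_map {A B : Type} (F : B -> R) (h : A -> B) (L : list A) :
  sum_list F (map h L) = sum_list (fun k => F (h k)) L.
Proof.
  unfold sum_list; now rewrite map_map.
Qed.

Lemma sum_list_flat_map {A B : Type} (F : B -> R) (h : A -> list B) (L : list A) :
  sum_list F (flat_map h L) = sum_list (fun k => sum_list F (h k)) L.
Proof.
  induction L as [|k L IH]; [reflexivity|]; simpl flat_map; rewrite sum_list_app, IH; reflexivity.
Qed.

Lemma sum_list_scal {A : Type} (r : R) (F : A -> R) (L : list A) :
  sum_list (fun k => r * F k) L = r * sum_list F L.
Proof.
  unfold sum_list; induction L as [|k L IH]; simpl; [ring|rewrite IH; ring].
Qed.

Lemma sum_list_filter {A : Type} (P : A -> bool) (F : A -> R) (L : list A) :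
  sum_list F (filter P L) = sum_list (fun k => if P k then F k else 0) L.
Proof.
  unfold sum_list; induction L as [|k L IH]; simpl; [reflexivity|].
  destruct (P k); simpl; rewrite IH; ring.
Qed.

Lemma sum_list_seq (F : nat -> R) (n : nat) : sum_list F (seq 0 (S n)) = sum_f_R0 F n.
Proof.
  induction n as [|n IH]; [unfold sum_list; simpl; ring|].
  rewrite seq_S, sum_list_app, IH; unfold sum_list; simpl; ring.
Qed.

Definition kterm (x : nat -> R) (t : R) (i0 : nat) (k : list nat) : R :=
  kmon x i0 k / kden i0 k * t ^ kwsum i0 k.

Lemma kterm_cons (x : nat -> R) (t : R) (i0 c : nat) (k : list nat) :
  kterm x t i0 (c :: k) =
    (x i0 / INR (fact i0) * t ^ i0) ^ c / INR (fact c) * kterm x t (S i0) k.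
Proof.
  unfold kterm, Rdiv; simpl.
  rewrite pow_add, (pow_mult t i0 c), !Rpow_mult_distr, !Rinv_mult, pow_inv; ring.
Qed.

Lemma sum_list_map_cons_kterm (x : nat -> R) (t : R) (i0 p c : nat) (L : list (list nat)) :
  sum_list (fun k => if Nat.eqb (ksum k) p then kterm x t i0 k else 0) (map (cons c) L)
  = if Nat.leb c p
    then (x i0 / INR (fact i0) * t ^ i0) ^ c / INR (fact c)
      * sum_list (fun k => if Nat.eqb (ksum k) (p - c) then kterm x t (S i0) k else 0) L
    else 0.
Proof.
  rewrite sum_list_map; destruct (Nat.leb_spec c p) as [Hc|Hc].
  - rewrite <- sum_list_scal; apply sum_list_ext; intros k; rewrite kterm_cons; simpl ksum.
    destruct (Nat.eqb_spec (c + ksum k) p), (Nat.eqb_spec (ksum k) (p - c)); try lia; ring.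
  - rewrite (sum_list_ext _ (fun _ => 0 * 0)), sum_list_scal; [ring|].
    intros k; simpl ksum; destruct (Nat.eqb_spec (c + ksum k) p); [lia|ring].
Qed.

Lemma multinomial_kvecs (x : nat -> R) (t : R) (b len : nat) : forall i0 p, (p <= b)%nat ->
  sum_list (fun k => if Nat.eqb (ksum k) p then kterm x t i0 k else 0) (kvecs len b)
  = sum_list (fun i => x i / INR (fact i) * t ^ i) (seq i0 len) ^ p / INR (fact p).
Proof.
  induction len as [|len IH]; intros i0 p Hp.
  - unfold sum_list, kterm; simpl; destruct p as [|p]; simpl; [field|].
    unfold Rdiv; rewrite !Rmult_0_l; ring.
  - cbn [kvecs]; rewrite sum_list_flat_map, sum_list_seq.
    set (y := x i0 / INR (fact i0) * t ^ i0).
    set (Q := sum_list (fun i => x i / INR (fact i) * t ^ i) (seq (S i0) len)).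
    rewrite (sum_f_R0_extend_0 _ p b Hp).
    + change (sum_list _ (seq i0 (S len))) with (y + Q); rewrite binomial.
      unfold Rdiv; rewrite Rmult_comm, scal_sum.
      apply sum_eq; intros c Hc.
      rewrite sum_list_map_cons_kterm, (proj2 (Nat.leb_le c p) Hc), IH by lia; fold y Q.
      unfold Binomial.C; field; repeat split; apply INR_fact_neq_0.
    + intros c Hc; rewrite sum_list_map_cons_kterm; destruct (Nat.leb_spec c p); [lia|reflexivity].
Qed.

Lemma is_expansion_poly (n : nat) : forall c,
  is_expansion (S n) (fun t => sum_f_R0 (fun i => c i * t ^ i) n) c.
Proof.
  induction n as [|n IH]; intros c.
  - exists (fun _ => 0); split; [apply filter_forall; intros t; simpl; ring|].
    apply is_expansion_0_continuous, continuous_const.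
  - exists (fun t => sum_f_R0 (fun i => PS_decr_1 c i * t ^ i) n); split; [|apply IH].
    apply filter_forall; intros t; rewrite decomp_sum, scal_sum by lia.
    simpl pow at 1; rewrite Rmult_1_r; f_equal.
    apply sum_eq; intros i Hi; unfold PS_decr_1; simpl; ring.
Qed.

Lemma is_expansion_sum_list_monomials {A : Type} (N : nat) (w : A -> R) (e : A -> nat)
  (L : list A) :
  is_expansion N (fun t => sum_list (fun k => w k * t ^ e k) L)
    (fun n => sum_list (fun k => if Nat.eqb (e k) n then w k else 0) L).
Proof.
  induction L as [|k L IH].
  - generalize (is_expansion_monomial N 0 0); apply is_expansion_ext.
    + apply filter_forall; intros t; unfold sum_list; simpl; ring.
    + now intros [|n] _.
  - exact (is_expansion_plus _ _ _ _ _ (is_expansion_monomial N (w k) (e k)) IH).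
Qed.

Definition egf_coef (x : nat -> R) (i : nat) : R :=
  match i with O => 0 | S _ => x i / INR (fact i) end.

Definition kvecs_coef (x : nat -> R) (j p n : nat) : R :=
  sum_list (fun k => if Nat.eqb (kwsum 1 k) n then kmon x 1 k / kden 1 k else 0)
    (filter (fun k => Nat.eqb (ksum k) p) (kvecs j j)).

Lemma is_expansion_egf_pow (x : nat -> R) (j p : nat) : (p <= j)%nat ->
  is_expansion (S j) (fun t => sum_f_R0 (fun i => egf_coef x i * t ^ i) j ^ p)
    (PS_scal (INR (fact p)) (kvecs_coef x j p)).
Proof.
  intros Hp.
  generalize (is_expansion_scal _ (INR (fact p)) _ _ (is_expansion_sum_list_monomials (S j)
    (fun k => kmon x 1 k / kden 1 k) (kwsum 1)
    (filter (fun k => Nat.eqb (ksum k) p) (kvecs j j)))).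
  apply is_expansion_ext; [|trivial]; apply filter_forall; intros t.
  rewrite sum_list_filter.
  rewrite (multinomial_kvecs x t j j 1 p Hp : sum_list (fun k => if Nat.eqb (ksum k) p
    then kmon x 1 k / kden 1 k * t ^ kwsum 1 k else 0) (kvecs j j) = _).
  rewrite <- sum_list_seq.
  replace (sum_list (fun i => egf_coef x i * t ^ i) (seq 0 (S j)))
    with (sum_list (fun i => x i / INR (fact i) * t ^ i) (seq 1 j)).
  - field; apply INR_fact_neq_0.
  - change (seq 0 (S j)) with (0 :: seq 1 j)%nat; rewrite <- seq_shift, !sum_list_map.
    unfold sum_list; simpl; rewrite map_map; simpl; ring.
Qed.

Lemma bell_kvecs_coef (j p : nat) (x : nat -> R) : bell j p x = INR (fact j) * kvecs_coef x j p j.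
Proof.
  unfold bell, kvecs_coef; fold (sum_list (fun k => INR (fact j) / kden 1 k * kmon x 1 k)
    (filter (fun k => andb (Nat.eqb (ksum k) p) (Nat.eqb (kwsum 1 k) j)) (kvecs j j))).
  rewrite !sum_list_filter, <- sum_list_scal; apply sum_list_ext; intros k.
  destruct (Nat.eqb (ksum k) p), (Nat.eqb (kwsum 1 k) j); simpl; unfold Rdiv; ring.
Qed.

(* Both sides are, up to [p!], the coefficient of [t^j] in [(sum_{1 <= i <= j} x_i t^i / i!)^p]. *)
Lemma bell_PS_pow (x : nat -> R) (j p : nat) : (p <= j)%nat ->
  bell j p x / INR (fact j) = PS_pow (egf_coef x) p j / INR (fact p).
Proof.
  intros Hp.
  rewrite (is_expansion_unique _ _ _ _
    (is_expansion_pow _ p _ _ (is_expansion_poly j (egf_coef x)))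
    (is_expansion_egf_pow x j p Hp) j (Nat.lt_succ_diag_r j)).
  rewrite bell_kvecs_coef; unfold PS_scal, scal; simpl; unfold mult; simpl.
  field; split; apply INR_fact_neq_0.
Qed.

(** * The substitution [xi = - ln (1 - t)] *)

Lemma lt_neg_ln_1_minus (t : R) : 0 < t < 1 -> t < - ln (1 - t).
Proof.
  intros Ht; enough (ln (1 - t) < ln (exp (- t))) by (rewrite ln_exp in *; lra).
  apply ln_increasing; [lra|]; generalize (exp_ineq1 (- t)); lra.
Qed.

Lemma is_expansion_neg_ln_div_minus_1 (N : nat) :
  is_expansion N (fun t => - ln (1 - t) / t - 1) (egf_coef bell_arg).
Proof.
  generalize (is_expansion_plus _ _ _ _ _
    (is_expansion_div_id N _ _ eq_refl (is_expansion_neg_ln_1_minus (S N)))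
    (is_expansion_monomial N (-1) 0)).
  apply is_expansion_ext; [apply filter_forall; intros t; simpl; ring|].
  intros [|n] _.
  - change (1 / 1 + -1 = 0); field.
  - change (1 / INR (S (S n)) + 0 = INR (fact (S n)) / INR (S (S n)) / INR (fact (S n))); field.
    split; [apply not_0_INR; lia|apply INR_fact_neq_0].
Qed.

Lemma is_expansion_neg_ln (N : nat) (r : R) (F : R -> R) (b : nat -> R) : is_expansion N F b ->
  is_expansion N (fun t => Rpower (- ln (1 - t) / t) (r - 1) * F (- ln (1 - t)))
    (fun n => sum_f_R0 (fun j => b (n - j)%nat
       * PS_comp (gbinom (r + INR (n - j) - 1)) (egf_coef bell_arg) j) n).
Proof.
  intros HF; set (u := fun t => - ln (1 - t) / t - 1).
  assert (Hu : at_right 0 (fun t => 0 < u t)).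
  { apply (at_right_0_intro 1 _ Rlt_0_1); intros t Ht; unfold u.
    assert (Hl := lt_neg_ln_1_minus t Ht).
    apply Rlt_0_minus, Rmult_lt_reg_r with t; [lra|].
    unfold Rdiv; rewrite Rmult_assoc, Rinv_l, Rmult_1_l, Rmult_1_r by lra; exact Hl. }
  generalize (is_expansion_Rpower_mult_comp u _ is_expansion_neg_ln_div_minus_1 eq_refl Hu
    N (r - 1) F b HF).
  apply is_expansion_ext.
  - apply (at_right_0_intro 1 _ Rlt_0_1); intros t Ht.
    replace (1 + u t) with (- ln (1 - t) / t) by (unfold u; ring).
    replace (t * (- ln (1 - t) / t)) with (- ln (1 - t)) by (field; lra); reflexivity.
  - intros n _; apply sum_eq; intros j _; do 3 f_equal; ring.
Qed.

Lemma sum_f_R0_sum_n_m (F : nat -> R) (n : nat) : sum_f_R0 F n = F O + sum_n_m F 1 n.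
Proof.
  rewrite <- sum_n_Reals; unfold sum_n; now rewrite sum_Sn_m by lia.
Qed.

Lemma PS_comp_gbinom_drj (rho : R) (j : nat) : 0 < rho -> (1 <= j)%nat ->
  PS_comp (gbinom (rho - 1)) (egf_coef bell_arg) j / Gamma rho = drj rho j / Gamma (rho + INR j).
Proof.
  intros Hrho Hj.
  assert (HG : 0 < Gamma rho) by now apply Gamma_pos.
  assert (HGj : 0 < Gamma (rho + INR j)) by (apply Gamma_pos; generalize (pos_INR j); lra).
  assert (Hterm : forall p, (1 <= p <= j)%nat -> bell j p bell_arg * rgamma (rho - INR p)
    = INR (fact j) / Gamma rho * (gbinom (rho - 1) p * PS_pow (egf_coef bell_arg) p j)).
  { intros p Hp; rewrite rgamma_minus_INR by trivial.
    replace (bell j p bell_arg) with (PS_pow (egf_coef bell_arg) p j / INR (fact p) * INR (fact j))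
      by (rewrite <- bell_PS_pow by lia; field; apply INR_fact_neq_0).
    unfold gbinom; field; repeat split; try lra; apply INR_fact_neq_0. }
  assert (Hsum : sum_n_m (fun p => bell j p bell_arg * rgamma (rho - INR p)) 1 j
    = INR (fact j) / Gamma rho
      * sum_n_m (fun p => gbinom (rho - 1) p * PS_pow (egf_coef bell_arg) p j) 1 j).
  { rewrite (sum_n_m_ext_loc _ _ 1 j Hterm); exact (sum_n_m_mult_l (K := R_Ring) _ _ 1 j). }
  unfold drj, PS_comp; rewrite Hsum, sum_f_R0_sum_n_m.
  destruct j as [|j]; [lia|]; simpl PS_pow at 1; rewrite Rmult_0_r, Rplus_0_l.
  field; repeat split; try lra; apply INR_fact_neq_0.
Qed.

Lemma sum_div_Gamma_PS_comp_gbinom (r : R) (A : nat -> R) (n : nat) : 0 < r ->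
  sum_f_R0 (fun j => A (n - j)%nat / Gamma (r + INR (n - j))
    * PS_comp (gbinom (r + INR (n - j) - 1)) (egf_coef bell_arg) j) n
  = / Gamma (r + INR n) * (A n + sum_n_m (fun j => drj (r + INR (n - j)) j * A (n - j)%nat) 1 n).
Proof.
  intros Hr; rewrite sum_f_R0_sum_n_m, Rmult_plus_distr_l; f_equal.
  - rewrite Nat.sub_0_r; unfold PS_comp, gbinom; simpl; field.
    apply Rgt_not_eq, Gamma_pos; generalize (pos_INR n); lra.
  - etransitivity; [|exact (sum_n_m_mult_l (K := R_Ring) _ _ 1 n)].
    apply sum_n_m_ext_loc; intros j Hj.
    assert (Hp : 0 < r + INR (n - j)) by (generalize (pos_INR (n - j)); lra).
    assert (Hdrj := PS_comp_gbinom_drj (r + INR (n - j)) j Hp (proj1 Hj)).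
    replace (r + INR (n - j) + INR j) with (r + INR n) in Hdrj by (rewrite minus_INR by lia; ring).
    transitivity (A (n - j)%nat * (drj (r + INR (n - j)) j / Gamma (r + INR n)));
      [rewrite <- Hdrj|]; unfold mult, Rdiv; simpl; ring.
Qed.

Lemma is_pseries_neg_ln_coef (r e : R) (A D : nat -> R) : 0 < r -> 0 < e <= 1 ->
  (forall t, 0 < t < e -> exists s,
     is_pseries (fun k => A k / Gamma (r + INR k)) (- ln (1 - t)) s /\
     is_pseries D t (Rpower (- ln (1 - t) / t) (r - 1) * s)) ->
  forall n, D n = / Gamma (r + INR n) *
    (A n + sum_n_m (fun j => drj (r + INR (n - j)) j * A (n - j)%nat) 1 n).
Proof.
  intros Hr He Hser n; rewrite <- sum_div_Gamma_PS_comp_gbinom by trivial.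
  set (b := fun k => A k / Gamma (r + INR k)) in *.
  assert (Hmid : 0 < e / 2 < e) by lra.
  destruct (Hser _ Hmid) as (s0 & Hb0 & HD0).
  assert (Hb : Rbar_lt 0 (CV_radius b)).
  { apply CV_radius_pos_of_is_pseries with (2 := Hb0).
    generalize (lt_neg_ln_1_minus (e / 2)); lra. }
  assert (HD : Rbar_lt 0 (CV_radius D)) by (apply CV_radius_pos_of_is_pseries with (2 := HD0); lra).
  refine (is_expansion_unique (S n) _ _ _ (is_expansion_PSeries _ D HD)
    (is_expansion_ext _ _ _ _ _ _ (fun _ _ => eq_refl)
      (is_expansion_neg_ln _ r _ _ (is_expansion_PSeries _ b Hb))) n (Nat.lt_succ_diag_r n)).
  apply (at_right_0_intro e _ (proj1 He)); intros t Ht.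
  destruct (Hser t Ht) as (s & Hbs & HDs).
  now rewrite (is_pseries_unique _ _ _ Hbs), (is_pseries_unique _ _ _ HDs).
Qed.

(** * From complex to real series *)

Lemma linear_sum_n_m {K : AbsRing} {U V : NormedModule K} (l : U -> V) (F : nat -> U) (n m : nat) :
  is_linear l -> l (sum_n_m F n m) = sum_n_m (fun k => l (F k)) n m.
Proof.
  intros Hl; unfold sum_n_m, Iter.iter_nat.
  induction (seq.iota n (S m - n)) as [|k L IH]; simpl.
  - now apply linear_zero.
  - exact (eq_trans (linear_plus l Hl _ _) (f_equal (plus (l (F k))) IH)).
Qed.

Lemma linear_is_series {K : AbsRing} {U V : NormedModule K} (l : U -> V) (F : nat -> U) (s : U) :
  is_linear l -> is_series F s -> is_series (fun k => l (F k)) (l s).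
Proof.
  intros Hl HF; apply (filterlim_ext (fun n => l (sum_n F n))).
  - intros n; now apply linear_sum_n_m.
  - apply filterlim_comp with (1 := HF); now apply linear_cont.
Qed.

Section RealLinearForm.

Variable l : C -> R.
Hypothesis Hl : is_linear (U := C_R_NormedModule) (V := R_NormedModule) l.

Lemma linear_Cmult_RtoC (x : R) (z : C) : l (RtoC x * z)%C = x * l z.
Proof.
  rewrite <- scal_R_Cmult; exact (linear_scal (U := C_R_NormedModule) l Hl x z).
Qed.

Lemma linear_Cplus (z w : C) : l (z + w)%C = l z + l w.
Proof.
  exact (linear_plus (U := C_R_NormedModule) l Hl z w).
Qed.

Lemma linear_sum_n_m_RtoC (x : nat -> R) (F : nat -> C) (n m : nat) :
  l (sum_n_m (fun k => RtoC (x k) * F k)%C n m) = sum_n_m (fun k => x k * l (F k)) n m.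
Proof.
  etransitivity; [exact (linear_sum_n_m (U := C_R_NormedModule) l _ n m Hl)|].
  apply sum_n_m_ext; intros k; apply linear_Cmult_RtoC.
Qed.

Lemma linear_is_pseries (F : nat -> C) (x : R) (s : C) :
  is_series (K := C_AbsRing) (V := C_NormedModule) (fun k => (F k * RtoC x ^ k)%C) s ->
  is_pseries (fun k => l (F k)) x (l s).
Proof.
  intros Hs; apply is_pseries_R.
  apply (is_series_ext (fun k => l (F k * RtoC x ^ k)%C)).
  - intros k; rewrite <- RtoC_pow, Cmult_comm, linear_Cmult_RtoC; apply Rmult_comm.
  - exact (linear_is_series (U := C_R_NormedModule) l _ _ Hl Hs).
Qed.

End RealLinearForm.

Definition neg_ln_series_eq (r : R) (A D : nat -> C) (t : R) : Prop :=
  exists s : C,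
    is_series (K := C_AbsRing) (V := C_NormedModule)
      (fun k => (A k * RtoC (- ln (1 - t)) ^ k / RtoC (Gamma (r + INR k)))%C) s /\
    is_series (K := C_AbsRing) (V := C_NormedModule)
      (fun j => (D j * RtoC t ^ j)%C) (RtoC (Rpower (- ln (1 - t) / t) (r - 1)) * s)%C.

Lemma is_series_neg_ln_coef (r e : R) (A D : nat -> C) : 0 < r -> 0 < e <= 1 ->
  (forall t, 0 < t < e -> neg_ln_series_eq r A D t) ->
  forall n, D n = (RtoC (/ Gamma (r + INR n)) *
    (A n + sum_n_m (fun j => RtoC (drj (r + INR (n - j)) j) * A (n - j)%nat) 1 n))%C.
Proof.
  intros Hr He Hser n.
  enough (Hlin : forall l : C -> R, is_linear (U := C_R_NormedModule) (V := R_NormedModule) l ->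
    l (D n) = l (RtoC (/ Gamma (r + INR n)) *
      (A n + sum_n_m (fun j => RtoC (drj (r + INR (n - j)) j) * A (n - j)%nat) 1 n))%C)
    by (apply injective_projections; apply Hlin; [apply is_linear_fst|apply is_linear_snd]).
  intros l Hl; rewrite linear_Cmult_RtoC, linear_Cplus, linear_sum_n_m_RtoC by exact Hl.
  apply (is_pseries_neg_ln_coef r e (fun k => l (A k)) (fun k => l (D k)) Hr He).
  intros t Ht; destruct (Hser t Ht) as (s & HA & HD); exists (l s); split.
  - apply is_pseries_ext with (fun k => l (A k / RtoC (Gamma (r + INR k)))%C).
    + intros k; assert (HG : 0 < Gamma (r + INR k))
        by (apply Gamma_pos; generalize (pos_INR k); lra).
      unfold Cdiv; rewrite <- RtoC_inv, Cmult_comm, linear_Cmult_RtoC by (trivial; lra).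
      apply Rmult_comm.
    + apply linear_is_pseries; [exact Hl|].
      refine (is_series_ext _ _ _ _ HA); intros k; unfold Cdiv.
      now rewrite <- !Cmult_assoc, (Cmult_comm (/ _)).
  - rewrite <- (linear_Cmult_RtoC l) by trivial; now apply linear_is_pseries.
Qed.

Lemma cexp_RtoC (x : R) : cexp (RtoC x) = RtoC (exp x).
Proof.
  unfold cexp, RtoC; simpl; rewrite cos_0, sin_0; f_equal; ring.
Qed.

Lemma clog_RtoC (x : R) : 0 < x -> clog (RtoC x) = RtoC (ln x).
Proof.
  intros Hx; unfold clog, carg; rewrite Cmod_R, Rabs_pos_eq by lra.
  unfold RtoC; simpl; destruct (Rlt_dec 0 x); [|lra].
  unfold Rdiv; now rewrite Rmult_0_l, atan_0.
Qed.

Lemma cpow_RtoC (x alpha : R) : 0 < x -> cpow (RtoC x) alpha = RtoC (Rpower x alpha).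
Proof.
  intros Hx; unfold cpow; rewrite clog_RtoC, <- RtoC_mult by trivial; apply cexp_RtoC.
Qed.

Lemma D11_1_minus (t : R) : 0 < t < 1 -> D11 (RtoC (1 - t)).
Proof.
  intros Ht; unfold D11; rewrite <- RtoC_minus, Cmod_R.
  replace (1 - t - 1) with (- t) by ring; rewrite Rabs_Ropp, Rabs_pos_eq; lra.
Qed.

Lemma is_series_restrict_real (r rho : R) (g : C -> C) (A D : nat -> C) : 0 < rho ->
  (forall xi : C, 0 < Cmod xi < rho -> exists S : C,
     is_series (K := C_AbsRing) (V := C_NormedModule)
       (fun k => (A k * xi ^ k / RtoC (Gamma (r + INR k)))%C) S /\
     g xi = (cpow (xi / (1 - cexp (- xi))) (r - 1) * S)%C) ->
  (forall s : C, D11 s -> is_series (K := C_AbsRing) (V := C_NormedModule)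
     (fun j => (D j * (1 - s) ^ j)%C) (g (- clog s)%C)) ->
  forall t, 0 < t < 1 - exp (- rho) -> neg_ln_series_eq r A D t.
Proof.
  intros Hrho Hg Hs t Ht; set (xi := - ln (1 - t)).
  assert (Hexp := exp_pos (- rho)).
  assert (Hxi : t < xi) by (apply lt_neg_ln_1_minus; lra).
  assert (Hxirho : xi < rho).
  { unfold xi; enough (ln (exp (- rho)) < ln (1 - t)) by (rewrite ln_exp in *; lra).
    apply ln_increasing; lra. }
  destruct (Hg (RtoC xi)) as (s & HA & Hgxi); [rewrite Cmod_R, Rabs_pos_eq; lra|].
  exists s; split; [exact HA|].
  assert (HD := Hs _ (D11_1_minus t ltac:(lra))).
  rewrite clog_RtoC, <- RtoC_opp in HD by lra; fold xi in HD.
  rewrite Hgxi, <- !RtoC_opp, cexp_RtoC, <- !RtoC_minus in HD.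
  replace (exp (- xi)) with (1 - t) in HD by (unfold xi; rewrite Ropp_involutive, exp_ln; lra).
  replace (1 - (1 - t)) with t in HD by ring.
  now rewrite <- RtoC_div, cpow_RtoC in HD by (try apply Rdiv_lt_0_compat; lra).
Qed.

Lemma exists_residue_quotient (m n : nat) : (1 <= m)%nat -> (1 <= n)%nat ->
  exists l q, (1 <= l <= m)%nat /\ n = (l + m * q)%nat.
Proof.
  intros Hm Hn; exists (S ((n - 1) mod m)), ((n - 1) / m)%nat.
  generalize (Nat.mod_upper_bound (n - 1) m) (Nat.div_mod_eq (n - 1) m); lia.
Qed.

Lemma sum_n_m_ltb_mul {G : AbelianMonoid} (F : nat -> nat -> G) (l m q : nat) :
  (1 <= l <= m)%nat ->
  sum_n_m (fun j => if Nat.ltb (j * m) (l + m * q) then F j (l + m * q - j * m)%nat else zero)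
    1 (l + m * q)
  = sum_n_m (fun j => F j (l + m * (q - j))%nat) 1 q.
Proof.
  intros Hl.
  rewrite (sum_n_m_Chasles _ 1 q) by nia.
  rewrite (sum_n_m_ext_loc _ (fun _ => zero) (S q)), sum_n_m_const_zero, plus_zero_r.
  - apply sum_n_m_ext_loc; intros j Hj.
    rewrite (proj2 (Nat.ltb_lt (j * m) (l + m * q))) by nia; f_equal; nia.
  - intros j Hj; destruct (Nat.ltb_spec (j * m) (l + m * q)); [nia|reflexivity].
Qed.

Lemma INR_plus_mul_div (l m k : nat) : (1 <= m)%nat ->
  INR (l + m * k) / INR m = INR l / INR m + INR k.
Proof.
  intros Hm; rewrite plus_INR, mult_INR; field; apply not_0_INR; lia.
Qed.

Theorem proposition5p5
  (m : nat) (Hm : (1 <= m)%nat) (a : nat -> C)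
  (* f is Gevrey-1 *)
  (Hgev : exists Cc K : R, forall n : nat,
      Cmod (a n) <= Cc * K ^ n * Gamma (1 + INR n / INR m))
  (* the Borel transform extends analytically to Omega* with the exponential bound *)
  (Hborel : exists (F : C -> C) (A B : R), 0 < A /\ 0 < B /\
      (forall w : C, F (Cplus w (0, 2 * PI * INR m)) = F w) /\
      (forall w : C, Omega_star w -> ex_derive (K := C_AbsRing) (V := C_NormedModule) F w) /\
      (exists r : R, 0 < r /\ forall w : C, Re w < ln r ->
          is_series (K := C_AbsRing) (V := C_NormedModule)
            (fun n : nat => if Nat.eqb n 0 then RtoC 0 else
               (a n * cexp (RtoC (INR n / INR m - 1) * w) / RtoC (Gamma (INR n / INR m)))%C)
            (F w)) /\
      (forall w : C, Omega_star w ->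
          Cmod (F w) * exp ((INR m - 1) / INR m * Re w) <= A * exp (B * exp (Re w))))
  (d : nat -> C)
  (* definition of the d_n through the g_l *)
  (Hd : forall l : nat, (1 <= l <= m)%nat ->
      exists g : C -> C,
        (forall xi : C, DeltaSet xi -> ex_derive (K := C_AbsRing) (V := C_NormedModule) g xi) /\
        (exists rho : R, 0 < rho /\ forall xi : C, 0 < Cmod xi < rho ->
           exists S : C,
             is_series (K := C_AbsRing) (V := C_NormedModule)
               (fun k : nat => (a (l + m * k)%nat * xi ^ k
                                / RtoC (Gamma (INR l / INR m + INR k)))%C) S /\
             g xi = (cpow (xi / (1 - cexp (- xi)))%C (INR l / INR m - 1) * S)%C) /\
        (forall s : C, D11 s ->
           is_series (K := C_AbsRing) (V := C_NormedModule)
             (fun j : nat => (d (l + m * j)%nat * (1 - s) ^ j)%C) (g (- clog s)%C))) :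
  forall n : nat, (1 <= n)%nat ->
    d n = (RtoC (/ Gamma (INR n / INR m)) *
           (a n + sum_n_m (fun j : nat =>
                    if Nat.ltb (j * m) n
                    then (RtoC (drj (INR (n - j * m) / INR m) j) * a (n - j * m)%nat)%C
                    else RtoC 0) 1 n))%C.
Proof.
  intros n Hn; destruct (exists_residue_quotient m n Hm Hn) as (l & q & Hl & ->).
  destruct (Hd l Hl) as (g & _ & (rho & Hrho & Hg) & Hs).
  assert (Hr : 0 < INR l / INR m) by (apply Rdiv_lt_0_compat; apply lt_0_INR; lia).
  assert (He : 0 < 1 - exp (- rho) <= 1).
  { assert (Hexp := exp_increasing (- rho) 0 ltac:(lra)); rewrite exp_0 in Hexp.
    generalize (exp_pos (- rho)); lra. }
  assert (Hcoef := is_series_neg_ln_coef _ _ _ (fun j => d (l + m * j)%nat) Hr He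
    (is_series_restrict_real _ _ g (fun k => a (l + m * k)%nat) _ Hrho Hg Hs) q).
  simpl in Hcoef; rewrite Hcoef, INR_plus_mul_div by trivial; do 2 f_equal; symmetry.
  etransitivity; [exact (sum_n_m_ltb_mul (G := C_AbelianGroup)
    (fun j i => RtoC (drj (INR i / INR m) j) * a i)%C l m q Hl)|].
  apply sum_n_m_ext; intros j; now rewrite INR_plus_mul_div.
Qed.
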